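(* Let $n\in\mathbb{N}$, $0< \gamma < \beta \leq n$ and $p\in[ \gamma / \beta,+\infty)$. (i) If $p>\frac{\gamma}{\beta}$, then there exists a constant $C=C(\gamma,\beta,n,p)>0$ such that for every $f \in L^p(\mathcal{H}^{\gamma}_\infty)$ $$\int_{\mathbb{R}^n} (\mathcal{M}_{\mathcal{H}^\beta_\infty} f)^p \, d \mathcal{H}^{\gamma}_\infty \leq C \int_{\mathbb{R}^n} |f|^p \, d \mathcal{H}^{\gamma}_\infty .$$ (ii) If $p =\frac{\gamma}{\beta}$, then there exists a constant $C=C(\gamma,\beta,n)>0$ such that for every $f \in L^p(\mathcal{H}^{\gamma}_\infty)$ and every $t>0$ $$\mathcal{H}^{\gamma}_\infty \left( \{ x\in \mathbb{R}^n: \mathcal{M}_{\mathcal{H}^\beta_\infty} f(x) >t \} \right) \leq \frac{C}{t^{p}} \int_{\mathbb{R}^n} |f|^p \, d \mathcal{H}^{\gamma}_\infty .$$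
   Context: For $\beta\in(0,n]$ the Hausdorff content of $E\subseteq\mathbb{R}^n$ is $\mathcal{H}^{\beta}_{\infty}(E):= \inf \{\sum_{i=1}^\infty \omega_{\beta} r_i^\beta : E \subset \bigcup_{i=1}^\infty B(x_i,r_i) \}$, where $\omega_\beta:= \pi^{\beta/2}/ \Gamma(\beta/2+1)$ and $B(x,r)$ is the open ball with center $x$ and radius $r$. For an $\mathcal{H}^\beta_\infty$-almost everywhere defined function $g$ with values in $[0,\infty]$, the Choquet integral is $\int_{\mathbb{R}^n} g \, d \mathcal{H}^{\beta}_\infty := \int_0^\infty \mathcal{H}^{\beta}_\infty(\{ g>t\})\,dt$, and $\int_{A} g\,d\mathcal{H}^\beta_\infty:=\int_{\mathbb{R}^n} g\chi_A\,d\mathcal{H}^\beta_\infty$ for $A\subseteq\mathbb{R}^n$. The same definitions apply with $\gamma$ in place of $\beta$. A function $f$ (real-valued, defined $\mathcal{H}^\gamma_\infty$-almost everywhere) is $\mathcal{H}^\gamma_\infty$-quasicontinuous if for every $\varepsilon>0$ there is an open set $O$ with $\mathcal{H}^\gamma_\infty(O)<\varepsilon$ such that $f$ restricted to $\mathbb{R}^n\setminus O$ is continuous. For $p\in(0,\infty)$, $L^p(\mathcal{H}^{\gamma}_{\infty})$ is the set of $\mathcal{H}^{\gamma}_{\infty}$-quasicontinuous functions $f$ with $(\int_{\mathbb{R}^n} |f|^p \, d \mathcal{H}^{\gamma}_\infty)^{1/p}<\infty$. The centered Hausdorff content maximal function is $$\mathcal{M}_{\mathcal{H}^\beta_\infty}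 f(x) := \sup_{r>0} \frac{1}{\omega_\beta r^\beta} \int_{B(x,r)} |f| \,d\mathcal{H}^{\beta}_{\infty}.$$ *)

(* Defs.v *)
From mathcomp Require Import all_boot all_order all_algebra.
From mathcomp Require Import all_classical all_reals all_analysis.
Set Implicit Arguments.
Unset Strict Implicit.
Unset Printing Implicit Defensive.
Import Order.TTheory GRing.Theory Num.Theory.
Import numFieldNormedType.Exports.
Local Open Scope classical_set_scope.
Local Open Scope ring_scope.

(* R^n is 'rV[R]_n with its library (product) topology, which is the Euclidean
   one. The library norm and [ball] on 'rV[R]_n come from the sup norm, hence
   the separate Euclidean ball. *)
Definition eucl_dist (R : realType) (n : nat) (x y : 'rV[R]_n) : R :=
  Num.sqrt (\sum_(i < n) (x ord0 i - y ord0 i) ^+ 2).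

Definition eucl_ball (R : realType) (n : nat) (x : 'rV[R]_n) (r : R) :
    set 'rV[R]_n :=
  [set y | eucl_dist x y < r].

Definition Gamma (R : realType) (s : R) : R :=
  \int[lebesgue_measure]_(t in `]0, +oo[) (t `^ (s - 1) * expR (- t)).

Definition omega (R : realType) (beta : R) : R :=
  pi `^ (beta / 2) / Gamma (beta / 2 + 1).

Definition hcontent (R : realType) (n : nat) (beta : R) (E : set 'rV[R]_n) :
    \bar R :=
  ereal_inf [set s | exists (c : nat -> 'rV[R]_n) (r : nat -> R),
    [/\ forall i, 0 < r i,
        E `<=` \bigcup_i eucl_ball (c i) (r i) &
        s = (\sum_(0 <= i <oo) (omega beta * r i `^ beta)%:E)%E]].

(* An almost everywhere defined function is a pair of a domain D and a total
   function of which only the values on D matter. *)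
Definition ae_domain (R : realType) (n : nat) (beta : R) (D : set 'rV[R]_n) :=
  hcontent beta (~` D) = 0%E.

Definition choquet (R : realType) (n : nat) (beta : R)
    (D : set 'rV[R]_n) (g : 'rV[R]_n -> \bar R) : \bar R :=
  (\int[lebesgue_measure]_(t in `]0%R, +oo[)
     hcontent beta [set x | D x /\ t%:E < g x])%E.

(* [g \_ A] is g times the indicator of A, as [point] is 0 in [\bar R]. *)
Definition choquet_on (R : realType) (n : nat) (beta : R)
    (A D : set 'rV[R]_n) (g : 'rV[R]_n -> \bar R) : \bar R :=
  choquet beta D (g \_ A).

Definition quasicontinuous (R : realType) (n : nat) (gamma : R)
    (D : set 'rV[R]_n) (f : 'rV[R]_n -> R) : Prop :=
  forall eps : R, 0 < eps -> exists O : set 'rV[R]_n,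
    [/\ open O, (hcontent gamma O < eps%:E)%E &
        {within D `\` O, continuous f}].

Definition Lp_hcontent (R : realType) (n : nat) (gamma p : R)
    (D : set 'rV[R]_n) (f : 'rV[R]_n -> R) : Prop :=
  [/\ ae_domain gamma D, quasicontinuous gamma D f &
      (choquet gamma D (fun x => (`|f x| `^ p)%:E) `^ p^-1 < +oo)%E].

Definition hmaximal (R : realType) (n : nat) (beta : R)
    (D : set 'rV[R]_n) (f : 'rV[R]_n -> R) (x : 'rV[R]_n) : \bar R :=
  ereal_sup [set ((omega beta * r `^ beta)^-1%:E *
      choquet_on beta (eucl_ball x r) D (fun y => `|f y|%:E))%E
    | r in [set r : R | 0 < r]].

(* Main.v *)
Require Import Defs.
From mathcomp Require Import all_boot all_order all_algebra.
From mathcomp Require Import all_classical all_reals all_analysis.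
From mathcomp Require Import measurable_realfun ring lra.
Import Order.TTheory GRing.Theory Num.Theory.
Import numFieldNormedType.Exports.
Local Open Scope classical_set_scope.
Local Open Scope ring_scope.

(* Let q = gamma / beta < 1 and t > 0. Cover each superlevel set {|f| > 2^k t},
   k >= 0, by balls B(c_kj, r_kj) that are almost optimal for the
   gamma-content. Let x lie outside all doubled balls and satisfy M f(x) > 2 t.
   The part of f below t contributes at most t to M f(x), so for some rho the
   balls meeting B(x, rho), which are all smaller than rho and hence centered in
   B(x, 2 rho), satisfy sum 2^k r_kj^beta >= rho^beta. As q < 1, this gives
   sum 2^(kq) r_kj^gamma >= rho^gamma: the discrete measure with mass
   2^(kq) r_kj^gamma at c_kj gives B(x, 2 rho) mass at least rho^gamma. A Vitali
   covering by such balls, together with the doubled balls, yields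
     H^gamma {M f > 2 t} <= C sum_k 2^(kq) H^gamma {|f| > 2^k t}.
   The weak type inequality is this estimate compared with the Choquet integral
   of |f|^q; the strong type one follows by integrating it in t, where the sum
   over k becomes a geometric series of ratio 2^(q - p). *)

(** * Euclidean balls and the Vitali covering lemma *)

Lemma eucl_dist_ge0 {R : realType} {n : nat} (x y : 'rV[R]_n) :
  0 <= eucl_dist x y.
Proof. exact: sqrtr_ge0. Qed.

Lemma eucl_distC {R : realType} {n : nat} (x y : 'rV[R]_n) :
  eucl_dist x y = eucl_dist y x.
Proof.
by congr Num.sqrt; apply: eq_bigr => i _; rewrite -sqrrN opprB.
Qed.

Lemma eucl_dist0 {R : realType} {n : nat} (x : 'rV[R]_n) : eucl_dist x x = 0.
Proof.
rewrite /eucl_dist big1 ?sqrtr0// => i _.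
by rewrite subrr expr0n.
Qed.

(** Lagrange's identity: the double sum of the squares (a_i b_j - a_j b_i)^2 is twice the difference
    of the two sides. *)
Lemma sum_mul_sqr_le {R : realType} {n : nat} (a b : 'I_n -> R) :
  (\sum_i a i * b i) ^+ 2 <= (\sum_i a i ^+ 2) * (\sum_i b i ^+ 2).
Proof.
have h : 0 <= \sum_i \sum_j (a i * b j - a j * b i) ^+ 2.
  by apply: sumr_ge0 => i _; apply: sumr_ge0 => j _; exact: sqr_ge0.
have e : \sum_i \sum_j (a i * b j - a j * b i) ^+ 2 =
    ((\sum_i a i ^+ 2) * (\sum_i b i ^+ 2) - (\sum_i a i * b i) ^+ 2) *+ 2.
  rewrite mulr2n {1}mulrC expr2 !big_distrlr/= -!sumrB -big_split/=.
  apply: eq_bigr => i _; rewrite -!sumrB -big_split/=.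
  by apply: eq_bigr => j _; ring.
by move: h; rewrite e pmulrn_lge0// subr_ge0.
Qed.

Lemma eucl_dist_triangle {R : realType} {n : nat} (y x z : 'rV[R]_n) :
  eucl_dist x z <= eucl_dist x y + eucl_dist y z.
Proof.
rewrite /eucl_dist.
set A := \sum_(i < n) (x ord0 i - y ord0 i) ^+ 2.
set B := \sum_(i < n) (y ord0 i - z ord0 i) ^+ 2.
pose P := \sum_(i < n) (x ord0 i - y ord0 i) * (y ord0 i - z ord0 i).
have A0 : 0 <= A by apply: sumr_ge0 => i _; exact: sqr_ge0.
have B0 : 0 <= B by apply: sumr_ge0 => i _; exact: sqr_ge0.
have -> : \sum_(i < n) (x ord0 i - z ord0 i) ^+ 2 = A + P *+ 2 + B.
  rewrite /A /B /P -sumrMnl -!big_split/=; apply: eq_bigr => i _.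
  by ring.
(* After squaring, it remains to compare [P] with the product of the two roots, which is
   Cauchy-Schwarz. *)
rewrite -[leRHS]ger0_norm ?addr_ge0 ?sqrtr_ge0// -sqrtr_sqr.
apply: ler_wsqrtr; rewrite sqrrD !sqr_sqrtr// lerD2r lerD2l lerMn2r/=.
rewrite -sqrtrM// (le_trans (ler_norm _))// -sqrtr_sqr.
by apply: ler_wsqrtr; exact: sum_mul_sqr_le.
Qed.

(* Zorn's lemma is applied to the disjoint subfamilies such that every ball of
   the whole family that meets the subfamily meets a member of at least half its
   radius: this property can be kept when a ball is added, provided that its
   radius is almost the largest among the balls missing the subfamily. *)
Lemma eucl_ball_vitali {R : realType} {n : nat} {I : Type} (S : set I)
    (c : I -> 'rV[R]_n) (r : I -> R) (M : R) :
    (forall i, S i -> 0 < r i <= M) ->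
  exists D : set I, [/\ D `<=` S,
    trivIset D (fun i => eucl_ball (c i) (r i)) &
    forall i, S i -> exists2 j, D j &
      eucl_ball (c i) (r i) `<=` eucl_ball (c j) (5 * r j)].
Proof.
move=> rM; set B := fun i => eucl_ball (c i) (r i).
pose P (D : set I) := [/\ D `<=` S, trivIset D B & forall i j, S i -> D j ->
  B i `&` B j !=set0 ->
  exists2 k, D k & B i `&` B k !=set0 /\ r i <= 2 * r k].
have [F FP Ftot|D [[DS tD Dr] Dmax]] := @Zorn_bigcup _ P.
  split.
  - by move=> i [X FX Xi]; have [XS _ _] := FP _ FX; exact: XS.
  - move=> i j [X FX Xi] [Y FY Yj] ij.
    have [_ tX _] := FP _ FX; have [_ tY _] := FP _ FY.
    by have [XY|YX] := Ftot _ _ FX FY; [apply: tY|apply: tX] => //;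
      [exact: XY|exact: YX].
  - move=> i j Si [X FX Xj] ij; have [_ _ Xr] := FP _ FX.
    by have [k Xk kP] := Xr _ _ Si Xj ij; exists k => //; exists X.
have Dmeet i : S i -> exists2 k, D k & B i `&` B k !=set0.
  move=> Si; apply: contrapT => Di.
  pose T := [set i | S i /\ forall k, D k -> ~ (B i `&` B k !=set0)].
  have Ti : T i by split=> // k Dk ik; apply: Di; exists k.
  have rT : has_sup (r @` T).
    split; first by exists (r i), i.
    by exists M => _ [j [Sj _] <-]; have /andP[] := rM _ Sj.
  have s0 : 0 < sup (r @` T).
    have /andP[ri0 _] := rM _ Si; apply: (lt_le_trans ri0).
    by apply: ub_le_sup; [exact: rT.2|exists i].
  have s2 : 0 < sup (r @` T) / 2 by rewrite divr_gt0.
  have [_ [j [Sj Tj] <-] rj] := sup_adherent s2 rT.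
  have {}rj : sup (r @` T) < 2 * r j by lra.
  have Bj0 : B j `&` B j !=set0.
    exists (c j); have /andP[rj0 _] := rM _ Sj.
    by split; rewrite /B /eucl_ball/= eucl_dist0.
  apply: (Dmax (D `|` [set j])).
    split; first by move=> k Dk; left.
    move=> /(_ j (or_intror erefl)) Dj.
    by apply: (Tj j).
  split.
  - by move=> k [/DS//|->].
  - move=> k l [Dk|->] [Dl|->] kl //; first exact: tD.
    + by exfalso; apply: (Tj k) => //; rewrite setIC.
    + by exfalso; apply: (Tj l).
  - move=> k l Sk Dl kl.
    (* A ball that meets a member of [D] keeps its old witness. Any other lies in [T], so its radius
       is at most the supremum, hence below 2 r_j. *)
    have [[m Dm km]|Dk] := pselect (exists2 m, D m & B k `&` B m !=set0).
      by have [m' Dm' m'P] := Dr _ _ Sk Dm km; exists m' => //; left.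
    case: Dl kl => [Dl kl|->{l} kl]; first by exfalso; apply: Dk; exists l.
    exists j; [by right|split => //].
    apply/ltW/(le_lt_trans _ rj)/ub_le_sup; first exact: rT.2.
    by exists k => //; split=> // m Dm km; apply: Dk; exists m.
exists D; split => // i Si; have [k Dk ik] := Dmeet i Si.
have [j Dj [[z [zi zj]] rij]] := Dr _ _ Si Dk ik.
exists j => // y yi; move: zi zj yi; rewrite /B /eucl_ball/= => zi zj yi.
(* Passing through z and c_i, the distance from c_j to y is below r_j + 2 r_i, and r_i <= 2 r_j
   gives the factor 5. *)
have h1 := eucl_dist_triangle (c i) (c j) y.
have h2 := eucl_dist_triangle z (c j) (c i).
move: h2; rewrite (eucl_distC z (c i)); lra.
Qed.

Lemma esumZl {R : realType} {T : choiceType} (A : set T) (a : T -> \bar R)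
    (k : R) : 0 <= k -> (forall i, 0 <= a i)%E ->
  (\esum_(i in A) (k%:E * a i) = k%:E * \esum_(i in A) a i)%E.
Proof.
move=> k0 a0; rewrite /esum -ereal_supZl//; last first.
  by apply/set0P; exists 0%E, set0; [split => //|rewrite fsbig_set0].
congr ereal_sup; rewrite image_comp; apply: eq_imagel => X [finX XA] /=.
by rewrite ge0_mule_fsumr.
Qed.
(** * Hausdorff content *)

(** The Gamma integral is never evaluated: wherever positivity of [omega] matters, the value 0 is
    handled as a separate, degenerate case. *)
Lemma omega_ge0 {R : realType} (b : R) : 0 <= omega b.
Proof.
rewrite /omega divr_ge0 ?powR_ge0//; apply: Rintegral_ge0 => t _.
by rewrite mulr_ge0 ?powR_ge0 ?expR_ge0.
Qed.

Section hcontent.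
Context {R : realType} {n : nat} (b : R).
Hypothesis b0 : 0 < b.
Implicit Types (E F : set 'rV[R]_n).
Local Open Scope ereal_scope.

Lemma hcontent_ge0 E : 0 <= hcontent b E.
Proof.
apply: le_ereal_inf_tmp => _ [c [r [_ _ ->]]].
by apply: nneseries_ge0 => i _ _; rewrite lee_fin mulr_ge0 ?omega_ge0 ?powR_ge0.
Qed.

Lemma le_hcontent E F : E `<=` F -> hcontent b E <= hcontent b F.
Proof.
move=> EF; apply: le_ereal_inf_tmp => _ [c [r [r0 Fcr ->]]].
apply: ereal_inf_lbound; exists c, r; split=> //.
exact: subset_trans Fcr.
Qed.

(* The cover may contain empty balls: the definition of the content allows only
   positive radii, so a radius r is replaced by (r^b + e 2^-i)^(1/b). *)
Lemma hcontent_le_series E (c : nat -> 'rV[R]_n) (r : nat -> R) :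
    (forall i, (0 <= r i)%R) -> E `<=` \bigcup_i eucl_ball (c i) (r i) ->
  hcontent b E <= \sum_(0 <= i <oo) (omega b * r i `^ b)%:E.
Proof.
move=> r0 Ecr; apply/lee_addgt0Pr => e e0.
have [w0|w0] := ltP 0%R (omega b); last first.
  have w_eq0 : omega b = 0%R by apply/eqP; rewrite eq_le w0 omega_ge0.
  apply: (@le_trans _ _ 0); last first.
    rewrite adde_ge0 ?lee_fin ?(ltW e0)// nneseries_ge0// => i _ _.
    by rewrite lee_fin mulr_ge0 ?omega_ge0 ?powR_ge0.
  apply: ereal_inf_lbound.
  (* Balls are free in this case, so any enlargement to positive radii will do. *)
  exists c, (fun i => (r i + 1)%R); split.
  - by move=> i; rewrite ltr_wpDl.
  - move=> x /Ecr[i _ xi]; exists i => //; apply: (lt_trans xi).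
    by rewrite ltrDl.
  - by rewrite eseries0// => i _ _; rewrite w_eq0 mul0r.
pose d i : R := (e / omega b / (2 ^ i.+1)%:R)%R.
have d0 i : (0 < d i)%R.
  apply: divr_gt0; first exact: divr_gt0.
  by rewrite ltr0n expn_gt0.
pose r' i := ((r i `^ b + d i) `^ b^-1)%R.
have r'0 i : (0 < r i `^ b + d i)%R by rewrite ltr_wpDl ?powR_ge0.
have r'b i : (r' i `^ b = r i `^ b + d i)%R.
  by rewrite /r' -powRrM mulVf ?gt_eqF// powRr1// ltW.
have rr' i : (r i <= r' i)%R.
  rewrite -[leLHS]powRr1// -(divff (lt0r_neq0 b0)) powRrM.
  rewrite ge0_ler_powR ?nnegrE ?powR_ge0 ?invr_ge0 ?(ltW b0)//; first exact/ltW.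
  by rewrite lerDl ltW.
apply: (@le_trans _ _ (\sum_(0 <= i <oo) (omega b * r' i `^ b)%:E)).
  apply: ereal_inf_lbound; exists c, r'; split=> //.
    by move=> i; rewrite powR_gt0.
  move=> x /Ecr[i _ xi]; exists i => //; exact: (lt_le_trans xi).
rewrite (eq_eseriesr (g := fun i => (omega b * r i `^ b)%:E +
    (e / (2 ^ i.+1)%:R)%:E)); last first.
  move=> i _; rewrite r'b -EFinD mulrDr; congr (_ + _)%:E.
  by rewrite /d mulrA mulrCA divff ?mulr1// gt_eqF.
apply: epsilon_trick; last exact: ltW.
by move=> i; rewrite lee_fin mulr_ge0 ?powR_ge0// ltW.
Qed.

Lemma hcontent_le_esum {T : pointedType} (A : set T) E (c : T -> 'rV[R]_n)
    (r : T -> R) : countable A -> (forall i, (0 <= r i)%R) ->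
    E `<=` \bigcup_(i in A) eucl_ball (c i) (r i) ->
  hcontent b E <= \esum_(i in A) (omega b * r i `^ b)%:E.
Proof.
move=> /countable_bijP[B /card_esym/card_set_bijP[f fB]] r0 Ecr.
rewrite (reindex_esum B A f)// esum_mkcond.
rewrite -nneseries_esumT; last first.
  by move=> i; case: ifP => // _; rewrite lee_fin mulr_ge0 ?omega_ge0 ?powR_ge0.
(* Indices outside [B] get radius 0, which costs nothing because b > 0. *)
rewrite (eq_eseriesr (g := fun i =>
    (omega b * (if i \in B then r (f i) else 0) `^ b)%:E)); last first.
  by move=> i _; case: ifP => // _; rewrite powR0 ?mulr0// gt_eqF.
apply: (hcontent_le_series E (c \o f)).
  by move=> i; case: ifP.
move=> x /Ecr[i Ai xi]; have [_ _ /(_ i Ai)[j Bj ji]] := fB.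
by exists j => //=; rewrite mem_set// ji.
Qed.

Lemma hcontent_cover E (e : R) : (0 < e)%R -> hcontent b E < +oo ->
  exists (c : nat -> 'rV[R]_n) (r : nat -> R), [/\ forall i, (0 < r i)%R,
    E `<=` \bigcup_i eucl_ball (c i) (r i) &
    \sum_(0 <= i <oo) (omega b * r i `^ b)%:E <= hcontent b E + e%:E].
Proof.
move=> e0 Ey; have Ef : hcontent b E \is a fin_num.
  by rewrite ge0_fin_numE ?hcontent_ge0.
have [_ [c [r [r0 Ec ->]] Er]] := lb_ereal_inf_adherent e0 Ef.
by exists c, r; split => //; exact: ltW.
Qed.

Lemma hcontentU E F : hcontent b (E `|` F) <= hcontent b E + hcontent b F.
Proof.
have [|Ef] := leP +oo (hcontent b E).
  rewrite leye_eq => /eqP ->.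
  by rewrite addye ?leey// -ltNye (lt_le_trans _ (hcontent_ge0 F))// ltNy0.
have [|Ff] := leP +oo (hcontent b F).
  rewrite leye_eq => /eqP ->.
  by rewrite addey ?leey// -ltNye (lt_le_trans _ (hcontent_ge0 E))// ltNy0.
apply/lee_addgt0Pr => e e0.
have e2 : (0 < e / 2)%R by rewrite divr_gt0.
have [c [r [r0 Ec Er]]] := hcontent_cover _ _ e2 Ef.
have [d [s [s0 Fd Fs]]] := hcontent_cover _ _ e2 Ff.
(* Two covers, each optimal up to e / 2, are merged into one family; the boolean tells which cover a
   ball comes from. *)
pose c' (i : bool * nat) := if i.1 then c i.2 else d i.2.
pose r' (i : bool * nat) := if i.1 then r i.2 else s i.2.
have EF : hcontent b (E `|` F) <=
    \esum_(i in [set: bool * nat]) (omega b * r' i `^ b)%:E.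
  apply: (hcontent_le_esum _ _ c').
  - exact: countableP.
  - by case=> -[i|i]; rewrite /r' /= ltW.
  - by move=> x [/Ec|/Fd] [i _ xi]; [exists (true, i)|exists (false, i)].
apply: (le_trans EF).
rewrite -setXTT -(esum_esum (J := fun=> setT)
  (a := fun i j => (omega b * r' (i, j) `^ b)%:E)); last first.
  by move=> i j _ _; rewrite lee_fin mulr_ge0 ?omega_ge0 ?powR_ge0.
rewrite esum_fset; last 2 first.
- exact: finite_finset.
- move=> i _; apply: esum_ge0 => j _.
  by rewrite lee_fin mulr_ge0 ?omega_ge0 ?powR_ge0.
rewrite setT_bool fsbigU0//=; last by move=> i [-> ?].
rewrite !fsbig_set1 -!nneseries_esumT.
- by rewrite (splitr e) EFinD addeACA; exact: leeD.
- by move=> i; rewrite lee_fin mulr_ge0 ?omega_ge0 ?powR_ge0.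
- by move=> i; rewrite lee_fin mulr_ge0 ?omega_ge0 ?powR_ge0.
Qed.

(** The balls of integer radius about the origin cover the whole space, at total cost 0. *)
Lemma hcontent_omega0 E : omega b = 0%R -> hcontent b E = 0.
Proof.
move=> w0; apply/eqP; rewrite eq_le hcontent_ge0 andbT.
have -> : 0 = \sum_(0 <= i <oo) (omega b * (i%:R : R) `^ b)%:E :> \bar R.
  by rewrite eseries0// => i _ _; rewrite w0 mul0r.
apply: (hcontent_le_series E (fun=> 0%R) (fun i => i%:R)%R) => // x _.
exists (Num.Def.archi_bound (eucl_dist 0 x)) => //.
exact/archi_boundP/eucl_dist_ge0.
Qed.

End hcontent.
(** * Integrals of nonincreasing functions *)

Section nonincreasing_integral.
Context {R : realType}.
Local Open Scope ereal_scope.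
Local Notation mu := (@lebesgue_measure R).
Implicit Types h : R -> \bar R.

(** Preimages of upper rays are intervals. This gives the measurability of the integrands in Choquet
    integrals, since contents of superlevel sets decrease with the level. *)
Lemma nonincreasing_emeasurable (D : set R) h : measurable D ->
  {homo h : x y / (x <= y)%R >-> y <= x} -> measurable_fun D h.
Proof.
move=> mD hni; apply: (measurability (@ErealGenCInfty.G R)).
  exact: ErealGenCInfty.measurableE.
move=> /= _ [_] [r] -> <-.
apply: measurableI => //; apply: is_interval_measurable => s t/=.
rewrite !in_itv/= !andbT => fs ft u /andP[su ut].
by rewrite in_itv/= andbT (le_trans ft)// hni.
Qed.

(** Lebesgue measure is [a] times its image under multiplication by [a]: both agree on half-open
    intervals, which determine it. *)
Lemma ge0_integral_scale h (a : R) : (0 < a)%R ->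
    measurable_fun setT h -> (forall s, 0 <= h s) ->
  \int[mu]_(s in `]0%R, +oo[) h (a * s)%R =
  a^-1%:E * \int[mu]_(s in `]0%R, +oo[) h s.
Proof.
move=> a0 mh h0.
have mf : measurable_fun setT ( *%R a : measurableTypeR R -> measurableTypeR R).
  exact: mulrl_measurable.
pose an : {nonneg R} := NngNum (ltW a0).
have mE (A : set (measurableTypeR R)) : measurable A ->
    mu A = mscale an (pushforward mu ( *%R a : measurableTypeR R -> measurableTypeR R)) A.
  apply: lebesgue_measure_unique => _ [[x y] _ <-] /=.
  rewrite /mscale/= /pushforward.
  rewrite (_ : _ @^-1` _ = `](x / a), (y / a)]%classic)%R; last first.
    apply/seteqP; split=> s /=; rewrite !in_itv/=;
      by rewrite ltr_pdivrMr// ler_pdivlMr// mulrC.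
  rewrite !lebesgue_measure_itv/= !lte_fin ltr_pM2r ?invr_gt0//.
  case: ifP => _; last by rewrite mule0.
  by rewrite -!EFinB -EFinM -mulrBl mulrC divfK// gt_eqF.
rewrite [in RHS](eq_measure_integral _ (fun A mA _ => mE mf A mA)).
rewrite [in RHS](ge0_integral_mscale _ _ an)//; last exact: measurable_funTS.
rewrite muleA -EFinM mulVf ?gt_eqF// mul1e.
rewrite ge0_integral_pushforward//; last exact: measurable_funTS.
congr integral; apply/seteqP; split=> s /=; rewrite !in_itv/= !andbT.
- by move=> s0; rewrite mulr_gt0.
- by rewrite pmulr_rgt0.
Qed.

Lemma integral_itv_cst (a b : R) (k : \bar R) : (0 <= a <= b)%R -> 0 <= k ->
  \int[mu]_(s in `]0%R, +oo[) (k * (\1_(`]a, b]%classic) s)%:E) =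
  (b - a)%:E * k.
Proof.
move=> /andP[a0 ab] k0.
rewrite ge0_integralZl//; last exact/measurable_EFinP/measurable_indic.
rewrite integral_indic//.
rewrite (_ : _ `&` _ = `]a, b]%classic); last first.
  apply/seteqP; split=> s /=; rewrite !in_itv/= ?andbT; first by case.
  by move=> /andP[sa sb]; split; [apply/andP|exact: le_lt_trans sa].
rewrite /= lebesgue_measure_itv/= lte_fin; case: ltgtP ab => // [ab _|-> _].
- by rewrite muleC.
- by rewrite subrr mule0 mul0e.
Qed.

(** Upper sum: [M] bounds h on ]0, t], and h (2^k t) bounds it on ]2^k t, 2^(k+1) t], an interval of
    length 2^k t. *)
Lemma integral_le_dyadic h (t : R) (M : \bar R) : (0 < t)%R ->
    {homo h : x y / (x <= y)%R >-> y <= x} -> (forall s, 0 <= h s) ->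
    (forall s, (0 < s)%R -> h s <= M) ->
  \int[mu]_(s in `]0%R, +oo[) h s <=
  t%:E * M + \sum_(0 <= k <oo) (2 ^+ k * t)%:E * h (2 ^+ k * t)%R.
Proof.
move=> t0 hni h0 hM.
have M0 : 0 <= M by exact: le_trans (hM _ ltr01).
pose u k s := h (2 ^+ k * t)%R * (\1_(`](2 ^+ k * t)%R, (2 ^+ k.+1 * t)%R]%classic) s)%:E.
have u0 k s : 0 <= u k s by rewrite mule_ge0// lee_fin.
have mu_ k : measurable_fun (`]0%R, +oo[%classic : set R) (u k).
  by apply: emeasurable_funM => //; exact/measurable_EFinP/measurable_indic.
pose v s := M * (\1_(`]0%R, t]%classic) s)%:E.
have v0 s : 0 <= v s by rewrite mule_ge0// lee_fin.
have mv : measurable_fun (`]0%R, +oo[%classic : set R) v.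
  by apply: emeasurable_funM => //; exact/measurable_EFinP/measurable_indic.
have ms : measurable_fun (`]0%R, +oo[%classic : set R) (fun s => \sum_(0 <= k <oo) u k s).
  by apply: ge0_emeasurable_sum => // k s _ _; exact: u0.
apply: (@le_trans _ _
    (\int[mu]_(s in `]0%R, +oo[) (v s + \sum_(0 <= k <oo) u k s))).
  apply: ge0_le_integral => //.
  - exact: nonincreasing_emeasurable.
  - exact: emeasurable_funD.
  move=> s /=; rewrite in_itv/= andbT => s0.
  have [st|ts] := leP s t.
    rewrite -[leLHS]adde0; apply: leeD; last exact: nneseries_ge0.
    by rewrite /v indicE mem_set ?mule1 ?hM//= in_itv/= s0.
  have tN0 : t != 0%R by rewrite gt_eqF.
  pose P k := (s <= 2 ^+ k * t)%R.
  have exP : exists k, P k.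
    exists (Num.Def.archi_bound (s / t)); rewrite /P -ler_pdivrMr// ltW//.
    exact: Num.Theory.upper_nthrootP.
  (* The least exponent with s <= 2^k t is not 0 as t < s; its predecessor indexes the dyadic
     interval containing s. *)
  case: (ex_minnP exP) => -[|k]; rewrite /P; first by rewrite mul1r leNgt ts.
  move=> sk kmin; have ks : (2 ^+ k * t < s)%R.
    by rewrite ltNge; apply/negP => /kmin; rewrite ltnn.
  apply: (@le_trans _ _ (u k s)).
    rewrite /u indicE mem_set ?mule1/= ?in_itv/= ?ks//.
    exact/hni/ltW.
  apply: le_trans (leeDr _ (v0 s)).
  have := @nneseries_lim_ge R (u^~ s) xpredT 0%N k.+1 (fun i _ _ => u0 i s).
  apply: le_trans.
  by rewrite big_nat_recr//= leeDr// sume_ge0.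
rewrite ge0_integralD//; last by move=> s _; exact: nneseries_ge0.
rewrite integral_nneseries// integral_itv_cst ?subr0 ?lexx ?(ltW t0)//.
rewrite leeD2l// lee_nneseries// => [k _ _|k _]; first exact: integral_ge0.
rewrite integral_itv_cst//; last first.
  by rewrite mulr_ge0 ?exprn_ge0 ?(ltW t0)//= ler_pM2r// ler_eXn2l ?ltr1n.
by rewrite lee_wpmul2r// lee_fin exprS; lra.
Qed.

(** Lower sum: on ]b_k, b_(k+1)] the function is at least its value at the right end. *)
Lemma integral_ge_series h (b : nat -> R) : (0 <= b 0%N)%R ->
    {homo b : i j / (i <= j)%N >-> (i <= j)%R} ->
    {homo h : x y / (x <= y)%R >-> y <= x} -> (forall s, 0 <= h s) ->
  \sum_(0 <= k <oo) (b k.+1 - b k)%:E * h (b k.+1) <=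
  \int[mu]_(s in `]0%R, +oo[) h s.
Proof.
move=> b0 bnd hni h0.
have bge0 k : (0 <= b k)%R by rewrite (le_trans b0)// bnd.
have mh (D : set R) : measurable D -> measurable_fun D h.
  by move=> mD; exact: nonincreasing_emeasurable.
apply: lime_le.
  by apply: is_cvg_nneseries => k _ _; rewrite mule_ge0// lee_fin subr_ge0 bnd.
apply: nearW => N.
apply: (@le_trans _ _ (\int[mu]_(s in `]0%R, b N]) h s)); last first.
  apply: ge0_subset_integral => //; first exact: mh.
  by move=> s /=; rewrite !in_itv/= => /andP[->].
elim: N => [|N ih]; first by rewrite big_geq// integral_ge0.
rewrite big_nat_recr//=.
rewrite (_ : `]0%R, b N.+1]%classic = `]0%R, b N] `|` `]b N, b N.+1]); last first.
  by rewrite -itv_bndbnd_setU// bnd_simp ?bnd.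
rewrite ge0_integral_setU//=; last 2 first.
- by apply: mh; exact: measurableU.
- apply/disj_setPS => s [] /=; rewrite !in_itv/= => /andP[_ sN] /andP[Ns _].
  by move: (lt_le_trans Ns sN); rewrite ltxx.
apply: leeD => //.
apply: (@le_trans _ _ (\int[mu]_(s in `]b N, b N.+1]) cst (h (b N.+1)) s)).
  rewrite integral_cst//= lebesgue_measure_itv/= lte_fin.
  case: ltgtP (bnd _ _ (leqnSn N)) => // [_ _|-> _]; first by rewrite muleC.
  by rewrite subrr mule0 mul0e.
apply: ge0_le_integral => //; first by move=> s _; exact: h0.
  exact: mh.
by move=> s /=; rewrite in_itv/= => /andP[_ sb]; exact: hni.
Qed.

End nonincreasing_integral.

(** * The level set estimate for the maximal function *)

(** The concave power p <= 1 lies above its chord on [0, A]; after scaling by A this is u <= u^p for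
    u <= 1. It converts sums of beta-powers of radii into sums of gamma-powers. *)
Lemma powR_le_chord {R : realType} (v A p : R) : 0 <= v -> 0 < A -> 0 < p <= 1 ->
  v `^ p <= A `^ p -> v <= A / A `^ p * v `^ p.
Proof.
move=> v0 A0 /andP[p0 p1] vA.
have Ap : 0 < A `^ p by rewrite powR_gt0.
have [->|vneq0] := eqVneq v 0; first by rewrite powR0 ?mulr0// gt_eqF.
have {}v0 : 0 < v by rewrite lt_neqAle eq_sym vneq0.
have vA' : v <= A.
  rewrite leNgt; apply/negP => Av; move: vA; rewrite leNgt => /negP; apply.
  by rewrite gt0_ltr_powR// nnegrE ltW.
have q1 : v / A <= (v / A) `^ p.
  by apply: ger1_powR => //; rewrite divr_gt0//= ler_pdivrMr// mul1r.
have -> : A / A `^ p * v `^ p = A * (v / A) `^ p.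
  have -> : (v / A) `^ p = v `^ p / A `^ p.
    by rewrite powRM ?invr_ge0 ?ltW// -powR_inv1 ?ltW// -powRrM mulN1r powRN.
  by ring.
by rewrite mulrC -ler_pdivrMr.
Qed.

Lemma esum_prodnat {R : realType} (u : nat * nat -> \bar R) :
  (forall i, 0 <= u i)%E ->
  (\esum_(i in setT) u i = \sum_(0 <= k <oo) \sum_(0 <= j <oo) u (k, j))%E.
Proof.
move=> u0; rewrite nneseries_esumT; last first.
  by move=> k; apply: nneseries_ge0 => j _ _; exact: u0.
under [RHS]eq_esum do rewrite nneseries_esumT//.
rewrite esum_esum; last by move=> *; exact: u0.
rewrite -setXTT; apply: eq_esum => -[] //.
Qed.

(** Each set contains one of countably many points, and disjoint sets contain different ones. It
    makes the Vitali subfamily countable, as a cover for the content must be. *)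
Lemma countable_trivIset_point {T : choiceType} {U : Type} (c : nat * nat -> U)
    (I : set T) (F : T -> set U) : trivIset I F ->
  (forall x, I x -> exists i, F x (c i)) -> countable I.
Proof.
move=> tI FI; have /choice[g gP] x : exists i, I x -> F x (c i).
  by have [/FI[i]|] := pselect (I x); [exists i|exists (0%N, 0%N)].
apply/countable_injP; exists (pickle \o g) => x y /set_mem Ix /set_mem Iy /=.
move=> /(pcan_inj pickleK) gxy; apply: tI => //.
by exists (c (g x)); split; [exact: gP|rewrite gxy; exact: gP].
Qed.

Definition superlevel {R : realType} {n : nat} (D : set 'rV[R]_n)
  (f : 'rV[R]_n -> R) (s : R) : set 'rV[R]_n := [set y | D y /\ s < `|f y|].

(* The ball (k, j) belongs to the cover of the k-th superlevel set, where f is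
   of size 2^k: this is its share of the integral of |f|^(gamma/beta). *)
Definition ball_weight {R : realType} (gamma beta : R) (r : nat * nat -> R)
  (i : nat * nat) : R := (2 ^+ i.1) `^ (gamma / beta) * r i `^ gamma.

Section maximal.
Context {R : realType} {n : nat}.
Variables (gamma beta : R).
Hypotheses (gamma0 : 0 < gamma) (gamma_beta : gamma < beta).
Implicit Types (D E : set 'rV[R]_n) (f : 'rV[R]_n -> R).
Local Open Scope ereal_scope.

Let beta0 : (0 < beta)%R. Proof. exact: lt_trans gamma_beta. Qed.

Lemma hcontent_ball (x : 'rV[R]_n) (r : R) : (0 <= r)%R ->
  hcontent beta (eucl_ball x r) <= (omega beta * r `^ beta)%:E.
Proof.
move=> r0.
rewrite -(@esum_set1 _ _ 0%N (fun=> (omega beta * r `^ beta)%:E)); last first.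
  by rewrite lee_fin mulr_ge0 ?omega_ge0 ?powR_ge0.
apply: (hcontent_le_esum _ beta0 _ _ (fun=> x) (fun=> r)) => //.
by move=> y xy; exists 0%N.
Qed.

Variables (D : set 'rV[R]_n) (f : 'rV[R]_n -> R) (t : R).
Hypothesis t0 : (0 < t)%R.

Local Notation level := (superlevel D f).

(** * Estimates for fixed covers of the superlevel sets *)

Section cover.
Variables (c : nat * nat -> 'rV[R]_n) (r : nat * nat -> R).
Hypothesis r0 : forall i, (0 <= r i)%R.
Hypothesis cover_level : forall k,
  level (2 ^+ k * t) `<=` \bigcup_j eucl_ball (c (k, j)) (r (k, j)).

Local Notation a := (ball_weight gamma beta r).

Let a0 i : (0 <= a i)%R. Proof. by rewrite mulr_ge0 ?powR_ge0. Qed.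

(** Dyadic upper sum for the Choquet integral: levels below t see at most the content of the ball
    itself, and inside it the level 2^k t is covered by those balls of the k-th cover that meet
    it. *)
Lemma choquet_on_ball_le (x : 'rV[R]_n) (rho : R) : (0 < rho)%R ->
  choquet_on beta (eucl_ball x rho) D (fun y => `|f y|%:E) <=
  (t * omega beta * rho `^ beta)%:E + (t * omega beta)%:E *
    \esum_(i in [set i | eucl_ball (c i) (r i) `&` eucl_ball x rho !=set0])
      (2 ^+ i.1 * r i `^ beta)%:E.
Proof.
move=> rho0; set N := [set i | _].
set g := (X in choquet_on _ _ _ X).
have lvl s : (0 < s)%R ->
    [set y | D y /\ s%:E < (g \_ (eucl_ball x rho)) y] `<=`
    level s `&` eucl_ball x rho.
  move=> s0 y [Dy]; rewrite patchE; case: ifPn => [/set_mem xy|_].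
    by rewrite lte_fin.
  by rewrite lte_fin => /(lt_trans s0); rewrite ltxx.
apply: le_trans (integral_le_dyadic _ t (omega beta * rho `^ beta)%:E t0 _ _ _) _.
- by move=> s u su; apply: le_hcontent => y [Dy uy]; split => //;
    apply: le_lt_trans uy; rewrite lee_fin.
- by move=> s; exact: hcontent_ge0.
- move=> s s0; apply: le_trans (hcontent_ball x _ (ltW rho0)).
  by apply: le_hcontent => y /(lvl _ s0)[].
rewrite -EFinM -mulrA leeD2l//.
(* Balls that miss B(x, rho) are shrunk to radius 0, so that the index set stays the full
   product. *)
pose r' i := if i \in N then r i else 0%R.
have r'0 i : (0 <= r' i)%R by rewrite /r'; case: ifP.
have r'E i : (2 ^+ i.1 * r' i `^ beta)%:E =
    if i \in N then (2 ^+ i.1 * r i `^ beta)%:E else 0.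
  by rewrite /r'; case: ifP => //; rewrite powR0 ?mulr0// gt_eqF.
have s0 i : 0 <= (2 ^+ i.1 * r' i `^ beta)%:E.
  by rewrite lee_fin mulr_ge0 ?exprn_ge0 ?powR_ge0.
rewrite esum_mkcond -(eq_esum (fun i _ => r'E i)).
rewrite esum_prodnat//.
rewrite -nneseriesZl; last by move=> k _; apply: nneseries_ge0 => j _ _.
apply: lee_nneseries => k *.
  by rewrite mule_ge0 ?hcontent_ge0// lee_fin mulr_ge0 ?exprn_ge0 ?ltW.
have kt0 : (0 < 2 ^+ k * t)%R by rewrite mulr_gt0 ?exprn_gt0.
apply: (@le_trans _ _ ((2 ^+ k * t)%:E *
    \sum_(0 <= j <oo) (omega beta * r' (k, j) `^ beta)%:E)).
  apply: lee_wpmul2l; first by rewrite lee_fin ltW.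
  apply: (hcontent_le_series _ beta0 _ (fun j => c (k, j))) => // y /(lvl _ kt0).
  move=> [/cover_level[j _ yj] xy]; exists j => //.
  by rewrite /r' mem_set//; exists y.
rewrite -!nneseriesZl.
- apply: lee_nneseries => j *.
    apply: mule_ge0; rewrite lee_fin; first exact: ltW.
    by rewrite mulr_ge0 ?omega_ge0 ?powR_ge0.
  by rewrite -!EFinM lee_fin le_eqVlt; apply/orP; left; apply/eqP; ring.
- by move=> j _; rewrite lee_fin mulr_ge0 ?exprn_ge0 ?omega_ge0 ?powR_ge0.
- by move=> j _; rewrite lee_fin mulr_ge0 ?exprn_ge0 ?omega_ge0 ?powR_ge0.
Qed.

Lemma hmaximal_gt_atoms (x : 'rV[R]_n) :
    (2 * t)%:E < hmaximal beta D f x ->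
    (forall i, ~ eucl_ball (c i) (2 * r i) x) ->
  exists2 rho, (0 < rho)%R & (rho `^ gamma)%:E <=
    \esum_(i in [set i | eucl_ball x (2 * rho) (c i)]) (a i)%:E.
Proof.
move=> /ereal_sup_gt[_ [rho rho0 <-]] Mx xc; exists rho => //.
(* If [omega beta] were 0, its inverse would be 0 by convention, and so would the average that
   exceeds 2 t. *)
have w0 : (0 < omega beta)%R.
  rewrite lt_neqAle omega_ge0 andbT; apply/eqP => w0; move: Mx.
  by rewrite -w0 mul0r invr0 mul0e lte_fin ltNge ltW// mulr_gt0.
have rb0 : (0 < rho `^ beta)%R by rewrite powR_gt0.
have rg0 : (0 < rho `^ gamma)%R by rewrite powR_gt0.
set N := [set i | eucl_ball (c i) (r i) `&` eucl_ball x rho !=set0].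
set S := \esum_(i in N) (2 ^+ i.1 * r i `^ beta)%:E.
(* Otherwise the average over B(x, rho) would be at most t + t. *)
have rhoS : (rho `^ beta)%:E <= S.
  rewrite leNgt; apply/negP => Srho.
  have S0 : 0 <= S.
    by apply: esum_ge0 => i _; rewrite lee_fin mulr_ge0 ?exprn_ge0 ?powR_ge0.
  move: Mx; apply/negP; rewrite -leNgt.
  rewrite (lee_pdivrMl _ _ (mulr_gt0 w0 rb0)).
  apply: (le_trans (choquet_on_ball_le x _ rho0)); rewrite -/N -/S.
  move: S0 Srho; case: S => // s; rewrite !lee_fin lte_fin => s0 srho.
  rewrite -lerBrDl (_ : _ - _ = t * omega beta * rho `^ beta)%R; last by ring.
  by rewrite (ler_pM2l (mulr_gt0 t0 w0)) ltW.
(* Here 2 r_i <= |c_i - x| < r_i + rho, so r_i < rho and |c_i - x| < 2 rho. *)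
have Nnear : N `<=` [set i | eucl_ball x (2 * rho) (c i)].
  move=> i [y [ciy xy]]; rewrite /= /eucl_ball /=.
  have /negP := xc i; rewrite /eucl_ball/= -leNgt => cix.
  move: ciy xy; rewrite /eucl_ball/= => ciy xy.
  have h := eucl_dist_triangle y (c i) x.
  rewrite (eucl_distC x); move: h; rewrite (eucl_distC y x); lra.
(* If the mass [G] is below rho^gamma, so is each single weight, and the chord bound applies term by
   term. It gives S <= rho^(beta - gamma) G < rho^beta, against [rhoS]. *)
rewrite leNgt; apply/negP => Grho.
set G := (X in X < _) in Grho.
have G0 : 0 <= G by apply: esum_ge0 => i _; rewrite lee_fin.
have aG i : N i -> (a i <= rho `^ gamma)%R.
  move=> Ni; rewrite -lee_fin; apply: le_trans (ltW Grho).
  apply: esum_ge; exists [set i].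
    by split; [exact: finite_set1|move=> _ ->; exact: Nnear].
  by rewrite fsbig_set1.
have vE (v : R) : (0 <= v)%R -> ((v `^ beta) `^ (gamma / beta) = v `^ gamma)%R.
  by move=> v0; rewrite -powRrM mulrCA divff ?mulr1// gt_eqF.
have Sle : S <= (rho `^ beta / rho `^ gamma)%:E * G.
  rewrite -esumZl; last 2 first.
  - by rewrite divr_ge0// ltW.
  - by move=> i; rewrite lee_fin.
  apply: (@le_trans _ _ (\esum_(i in N) ((rho `^ beta / rho `^ gamma)%:E * (a i)%:E))).
    apply: le_esum => i Ni.
    rewrite -EFinM lee_fin.
    have aE : a i = ((2 ^+ i.1 * r i `^ beta) `^ (gamma / beta))%R.
      by rewrite powRM ?exprn_ge0 ?powR_ge0// vE.
    rewrite aE -(vE rho (ltW rho0)); apply: powR_le_chord => //.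
    - by rewrite mulr_ge0 ?exprn_ge0 ?powR_ge0.
    - by rewrite divr_gt0//= ler_pdivrMr// mul1r ltW.
    - by rewrite -aE vE ?(ltW rho0)// aG.
  rewrite esum_mkcond [leRHS]esum_mkcond; apply: le_esum => i _.
  case: ifPn => [/set_mem/Nnear iN|_]; first by rewrite mem_set.
  by case: ifP => // _; rewrite -EFinM lee_fin mulr_ge0// divr_ge0// ltW.
move: G0 Grho Sle; case: G => // g; rewrite lee_fin lte_fin => g0 grho.
move/(le_trans rhoS); rewrite -EFinM lee_fin.
by rewrite leNgt mulrAC -mulrA gtr_pMr// ltr_pdivrMr// mul1r grho.
Qed.

(** The doubled balls [U] and the rest [V] each cost at most 10^gamma times the total weight. For
    [V], 10 is the Vitali factor 5 applied to radii 2 rho; for [U], 2 <= 10 suffices, as the factors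
    2^(kq) are at least 1. *)
Lemma hcontent_hmaximal_le_cover : (0 < omega gamma)%R ->
  hcontent gamma [set x | (2 * t)%:E < hmaximal beta D f x] <=
  (2 * 10 `^ gamma)%:E * \esum_(i in setT) (omega gamma * a i)%:E.
Proof.
move=> w0; set E := [set x | _].
have wa0 i : 0 <= (omega gamma * a i)%:E by rewrite lee_fin mulr_ge0 ?omega_ge0.
set G := esum setT _.
have G0 : 0 <= G by exact: esum_ge0.
have C0 : (0 < 10 `^ gamma :> R)%R by rewrite powR_gt0.
have [|Gy] := leP +oo G.
  by rewrite leye_eq => /eqP ->; rewrite gt0_muley ?leey// lte_fin mulr_gt0.
have GE : G = (omega gamma)%:E * \esum_(i in setT) (a i)%:E.
  by rewrite -esumZl// ltW.
have sy : \esum_(i in setT) (a i)%:E < +oo.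
  rewrite ltey; apply/eqP => ay; move: Gy.
  by rewrite GE ay gt0_muley ?ltxx// lte_fin.
pose U := \bigcup_(i in setT) eucl_ball (c i) (2 * r i).
have hU : hcontent gamma U <= (10 `^ gamma)%:E * G.
  apply: (@le_trans _ _ (\esum_(i in setT) (omega gamma * (2 * r i) `^ gamma)%:E)).
    apply: (hcontent_le_esum _ gamma0 _ _ c) => //; first exact: countableP.
    by move=> i; rewrite mulr_ge0.
  rewrite /G -esumZl// ?powR_ge0//; apply: le_esum => i _.
  rewrite -EFinM lee_fin mulrCA ler_pM2l// /ball_weight.
  rewrite powRM// mulrCA -[leLHS]mul1r ler_pM//.
  - by rewrite mulr_ge0 ?powR_ge0.
  - rewrite -[leLHS](powRr0 (2 ^+ i.1)) ler_powR// ?exprn_ege1 ?ler1n//.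
    by rewrite divr_ge0 ?ltW.
  - rewrite ler_wpM2r ?powR_ge0// ge0_ler_powR ?nnegrE ?(ltW gamma0)//.
    by rewrite ler_nat.
pose V := E `\` U.
have /choice[rho rhoP] x : exists q, (0 < q)%R /\ (V x ->
    (q `^ gamma)%:E <= \esum_(i in [set i | eucl_ball x (2 * q) (c i)]) (a i)%:E).
  have [[Ex Ux]|] := pselect (V x); last by exists 1%R.
  have [|q q0 qP] := hmaximal_gt_atoms x Ex; last by exists q.
  by move=> i xi; apply: Ux; exists i.
have rho0 x : (0 < rho x)%R by have [] := rhoP x.
have le_total_mass (A : set (nat * nat)) :
    \esum_(i in A) (a i)%:E <= \esum_(i in setT) (a i)%:E.
  rewrite esum_mkcond; apply: le_esum => i _; case: ifP => // _.
  by rewrite lee_fin.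
set M := \esum_(i in setT) (a i)%:E in sy le_total_mass.
(* Since rho^gamma is at most the finite total mass, the radii are bounded, as the Vitali lemma
   requires. *)
have rhoM x : V x -> (0 < 2 * rho x <= 2 * fine M `^ gamma^-1)%R.
  move=> Vx; rewrite mulr_gt0//= ler_pM2l//.
  have : (rho x `^ gamma <= fine M)%R.
    rewrite -lee_fin fineK; first exact: le_trans ((rhoP x).2 Vx) (le_total_mass _).
    by rewrite ge0_fin_numE// esum_ge0// => i _; rewrite lee_fin.
  move=> h; rewrite -[leLHS]powRr1 ?(ltW (rho0 x))//.
  rewrite -(divff (lt0r_neq0 gamma0)) powRrM ge0_ler_powR ?invr_ge0 ?(ltW gamma0)//.
  - by rewrite nnegrE powR_ge0.
  - by rewrite nnegrE (le_trans _ h) ?powR_ge0.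
have [I [IV tI Icover]] := eucl_ball_vitali V id (fun x => 2 * rho x)%R _ rhoM.
pose A x := [set i | eucl_ball x (2 * rho x) (c i)].
have cI : countable I.
  apply: (countable_trivIset_point c) tI _ => x /IV Vx.
  apply: contrapT => nx; have := (rhoP x).2 Vx.
  rewrite -/(A x) (_ : A x = set0) ?esum_set0; last first.
    by apply/seteqP; split=> // i xi; apply: nx; exists i.
  by rewrite lee_fin leNgt powR_gt0.
have hV : hcontent gamma V <= (10 `^ gamma)%:E * G.
  apply: (@le_trans _ _
      (\esum_(x in I) (omega gamma * (10 * rho x) `^ gamma)%:E)).
    apply: (hcontent_le_esum _ gamma0 _ _ id) => //.
      by move=> x; rewrite mulr_ge0 ?ltW.
    move=> x Vx; have [y Iy xy] := Icover x Vx; exists y => //.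
    have -> : (10 * rho y = 5 * (2 * rho y))%R by ring.
    by apply: xy; rewrite /eucl_ball/= eucl_dist0 mulr_gt0.
  apply: (@le_trans _ _ (\esum_(x in I)
      ((10 `^ gamma)%:E * \esum_(i in A x) (omega gamma * a i)%:E))).
    apply: le_esum => x /IV Vx.
    under eq_esum do rewrite EFinM.
    rewrite esumZl ?(ltW w0)//.
    rewrite powRM ?(ltW (rho0 x))// mulrCA EFinM lee_wpmul2l ?lee_fin ?(ltW C0)//.
    rewrite EFinM lee_wpmul2l ?lee_fin ?(ltW w0)//.
    exact: (rhoP x).2.
  rewrite esumZl ?(ltW C0)//; last by move=> x; exact: esum_ge0.
  rewrite lee_wpmul2l ?lee_fin ?(ltW C0)//.
  rewrite esum_esum//.
  (* By disjointness each atom lies in at most one selected ball, so no weight is counted twice. *)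
  rewrite -(esum_image (I `*`` A) snd (fun i => (omega gamma * a i)%:E)); last first.
    move=> [x i] [y j] /set_mem[/= Ix xi] /set_mem[/= Iy yj] ij.
    by rewrite ij in xi *; congr pair; apply: tI => //; exists (c j).
  by rewrite esum_mkcond; apply: le_esum => i _; case: ifP.
have EUV : E `<=` U `|` V.
  by move=> x Ex; have [Ux|Ux] := pselect (U x); [left|right].
apply: le_trans (le_hcontent gamma _ _ EUV) _.
apply: le_trans (hcontentU gamma gamma0 U V) _.
rewrite mulr_natl mulr2n EFinD ge0_muleDl ?lee_fin ?(ltW C0)//.
exact: leeD.
Qed.

End cover.
Lemma hcontent_hmaximal_le :
  hcontent gamma [set x | (2 * t)%:E < hmaximal beta D f x] <=
  (2 * 10 `^ gamma)%:E * \sum_(0 <= k <oo)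
    ((2 ^+ k) `^ (gamma / beta))%:E * hcontent gamma (level (2 ^+ k * t)).
Proof.
have [w0|w_le0] := ltP 0%R (omega gamma); last first.
  have w0 : omega gamma = 0%R by apply/eqP; rewrite eq_le w_le0 omega_ge0.
  rewrite (hcontent_omega0 gamma gamma0 _ w0) mule_ge0//.
  apply: nneseries_ge0 => k _ _.
  by rewrite mule_ge0 ?hcontent_ge0// lee_fin powR_ge0.
have C0 : (0 < 2 * 10 `^ gamma :> R)%R by rewrite mulr_gt0 ?powR_gt0.
pose q k : R := ((2 ^+ k) `^ (gamma / beta))%R.
have q0 k : (0 < q k)%R by rewrite powR_gt0 ?exprn_gt0.
have h0 k : 0 <= (q k)%:E * hcontent gamma (level (2 ^+ k * t)).
  by rewrite mule_ge0 ?hcontent_ge0// lee_fin ltW.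
(* One level of infinite content makes the right-hand side infinite, because its factor is
   positive. *)
have [hy|] := pselect (forall k, hcontent gamma (level (2 ^+ k * t)) < +oo); last first.
  move=> /existsNP[k /negP]; rewrite -leNgt leye_eq => /eqP hk.
  rewrite (@nneseriesD1 R _ k xpredT (fun i _ => h0 i) isT) hk.
  rewrite gt0_muley ?lte_fin// addye ?gt0_muley ?leey ?lte_fin//.
  rewrite -ltNye (lt_le_trans (ltNy0 : -oo < (0 : \bar R)))//.
  by apply: nneseries_ge0 => i _ _; exact: h0.
rewrite -lee_pdivrMl//; apply/lee_addgt0Pr => e e0.
(* The k-th cover may exceed the content by [d k]; after weighting by [q k] the errors are e /
   2^(k+1), with sum e. *)
pose d k : R := (e / (2 ^ k.+1)%:R / q k)%R.
have d0 k : (0 < d k)%R.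
  by apply: divr_gt0 => //; apply: divr_gt0 => //; rewrite ltr0n expn_gt0.
have /choice[c cP] k := hcontent_cover gamma _ _ (d0 k) (hy k).
have /choice[r rP] := cP.
pose c' i := c i.1 i.2; pose r' i := r i.1 i.2.
have r'0 i : (0 <= r' i)%R by have [r0 _ _] := rP i.1; exact/ltW/r0.
rewrite lee_pdivrMl//.
apply: le_trans (hcontent_hmaximal_le_cover c' r' r'0 _ w0) _.
  by move=> k; have [] := rP k.
rewrite lee_wpmul2l ?lee_fin ?(ltW C0)//.
rewrite esum_prodnat; last first.
  by move=> i; rewrite lee_fin mulr_ge0 ?omega_ge0 ?mulr_ge0 ?powR_ge0.
apply: le_trans (epsilon_trick xpredT h0 (ltW e0)).
apply: lee_nneseries => k *.
  apply: nneseries_ge0 => j _ _.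
  by rewrite lee_fin mulr_ge0 ?omega_ge0 ?mulr_ge0 ?powR_ge0.
have -> : (e / (2 ^ k.+1)%:R)%:E = (q k)%:E * (d k)%:E.
  by rewrite -EFinM /d [in RHS]mulrC divfK// gt_eqF.
rewrite -ge0_muleDr ?hcontent_ge0 ?lee_fin ?(ltW (d0 k))//.
have [_ _ rk] := rP k.
apply: le_trans (lee_wpmul2l _ rk); last by rewrite lee_fin ltW.
rewrite -nneseriesZl; last by move=> j _; rewrite lee_fin mulr_ge0 ?omega_ge0 ?powR_ge0.
apply: lee_nneseries => j *.
  by rewrite lee_fin mulr_ge0 ?omega_ge0 ?mulr_ge0 ?powR_ge0.
by rewrite -EFinM lee_fin mulrCA.
Qed.

End maximal.

(** * Weak and strong type inequalities *)

Lemma powR2_lt1 {R : realType} (y : R) : y < 0 -> 2 `^ y < 1.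
Proof.
move=> y0; rewrite -[y]opprK powRN invf_lt1 ?powR_gt0//.
rewrite [ltLHS](_ : 1 = 1 `^ (- y)); last by rewrite powR1.
by rewrite gt0_ltr_powR ?nnegrE ?oppr_gt0 ?ltr1n.
Qed.

Section choquet_hmaximal.
Context {R : realType} {n : nat}.
Variables (gamma beta p : R).
Hypotheses (gamma0 : 0 < gamma) (gamma_beta : gamma < beta) (p0 : 0 < p).
Variables (D : set 'rV[R]_n) (f : 'rV[R]_n -> R).
Local Open Scope ereal_scope.
Local Notation mu := (@lebesgue_measure R).

(** The distribution function of |f|^p, whose integral over ]0, +oo[ is the Choquet integral on the
    right of both inequalities. *)
Let phi (s : R) := hcontent gamma [set y | D y /\ s%:E < (`|f y| `^ p)%:E].

Let phi_ni : {homo phi : x y / (x <= y)%R >-> y <= x}.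
Proof.
move=> s u su; apply: le_hcontent => y [Dy uy]; split=> //.
by apply: le_lt_trans uy; rewrite lee_fin.
Qed.

Let phi_ge0 s : 0 <= phi s. Proof. exact: hcontent_ge0. Qed.

Lemma hcontent_hmaximal_le_choquet_level (t : R) : (0 < t)%R ->
  hcontent gamma [set x | t%:E < hmaximal beta D f x] <=
  (2 * 10 `^ gamma)%:E * \sum_(0 <= k <oo) ((2 ^+ k) `^ (gamma / beta))%:E *
    hcontent gamma [set y | D y /\ ((2 ^+ k * (t / 2)) `^ p)%:E < (`|f y| `^ p)%:E].
Proof.
move=> t0; have t20 : (0 < t / 2)%R by rewrite divr_gt0.
rewrite {1}(_ : t = 2 * (t / 2))%R; last by rewrite mulrC divfK.
apply: le_trans (hcontent_hmaximal_le _ _ gamma0 gamma_beta D f _ t20) _.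
apply: lee_wpmul2l; first by rewrite lee_fin mulr_ge0 ?powR_ge0.
apply: lee_nneseries => k *.
  by rewrite mule_ge0 ?hcontent_ge0// lee_fin powR_ge0.
apply: lee_wpmul2l; first by rewrite lee_fin powR_ge0.
apply: le_hcontent => y [Dy ty]; split=> //.
rewrite lte_fin; apply: gt0_ltr_powR => //; rewrite nnegrE//.
by rewrite mulr_ge0 ?exprn_ge0 ?ltW.
Qed.

(** For p = gamma / beta the series of levels is, up to a constant, a lower sum for the integral of
    [phi]. *)
Lemma weak_hmaximal (t : R) : p = (gamma / beta)%R -> (0 < t)%R ->
  hcontent gamma [set x | t%:E < hmaximal beta D f x] <=
  (2 * 10 `^ gamma / (2^-1 `^ p - 4^-1 `^ p) / t `^ p)%:E *
    choquet gamma D (fun x => (`|f x| `^ p)%:E).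
Proof.
move=> pE t0; set I := choquet _ _ _.
have t20 : (0 < t / 2)%R by rewrite divr_gt0.
have delta0 : (0 < 2^-1 `^ p - 4^-1 `^ p :> R)%R.
  by rewrite subr_gt0 gt0_ltr_powR ?nnegrE//; lra.
have tp0 : (0 < t `^ p)%R by rewrite powR_gt0.
apply: le_trans (hcontent_hmaximal_le_choquet_level _ t0) _.
rewrite -[(_ / _ / t `^ p)%R]mulrA -invfM [X in _ <= X * I]EFinM -muleA.
apply: lee_wpmul2l; first by rewrite lee_fin mulr_ge0 ?powR_ge0.
rewrite lee_pdivlMl ?mulr_gt0// -nneseriesZl; last first.
  by move=> k _; rewrite mule_ge0 ?hcontent_ge0// lee_fin powR_ge0.
(* The nodes are the levels shifted back by one: [b k.+1] is the k-th level, and b_(k+1) - b_k =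
   2^(kp) t^p (2^-p - 4^-p) is proportional to the weight 2^(kp). *)
pose b k : R := ((2 ^+ k * (t / 4)) `^ p)%R.
have bS k : b k.+1 = ((2 ^+ k * (t / 2)) `^ p)%R.
  by rewrite /b exprS; congr (_ `^ _)%R; field.
apply: le_trans (integral_ge_series phi b _ _ phi_ni phi_ge0); last 2 first.
- by rewrite powR_ge0.
- move=> i j ij; rewrite /b ge0_ler_powR ?nnegrE ?(ltW p0)//.
  + by rewrite mulr_ge0 ?exprn_ge0// divr_ge0// ltW.
  + by rewrite mulr_ge0 ?exprn_ge0// divr_ge0// ltW.
  + by rewrite ler_wpM2r ?divr_ge0 ?(ltW t0)// ler_eXn2l ?ltr1n.
apply: lee_nneseries => k *.
  rewrite mule_ge0 ?lee_fin ?mulr_ge0 ?(ltW delta0) ?(ltW tp0)//.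
  by rewrite mule_ge0 ?hcontent_ge0// lee_fin powR_ge0.
rewrite muleA -EFinM bS /phi -pE.
rewrite le_eqVlt; apply/orP; left; apply/eqP; congr (_%:E * _).
rewrite /b !powRM ?exprn_ge0 ?divr_ge0 ?(ltW t0)//.
by ring.
Qed.

Lemma hmaximal_ge0 (x : 'rV[R]_n) : 0 <= hmaximal beta D f x.
Proof.
set u := (omega beta * 1 `^ beta)^-1%:E *
  choquet_on beta (eucl_ball x 1) D (fun y => `|f y|%:E).
apply: (@le_trans _ _ u); last by apply: ereal_sup_ubound; exists 1%R => //=.
apply: mule_ge0; last by apply: integral_ge0 => s _; exact: hcontent_ge0.
by rewrite lee_fin invr_ge0; apply: mulr_ge0; rewrite ?omega_ge0 ?powR_ge0.
Qed.

(** The level estimate at s^(1/p) involves [phi] at c_k s, with c_k = (2^k / 2)^p. Integrating in s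
    turns its k-th term into (q_k / c_k) I = 2^p z^k I, a geometric series since z = 2^(gamma/beta -
    p) < 1. *)
Lemma strong_hmaximal : (gamma / beta < p)%R ->
  choquet gamma setT (fun x => hmaximal beta D f x `^ p) <=
  (2 * 10 `^ gamma * (2 `^ p / (1 - 2 `^ (gamma / beta - p))))%:E *
    choquet gamma D (fun x => (`|f x| `^ p)%:E).
Proof.
move=> gbp; set I := choquet gamma D _.
have C0 : (0 < 2 * 10 `^ gamma :> R)%R by rewrite mulr_gt0 ?powR_gt0.
pose z : R := (2 `^ (gamma / beta - p))%R.
have z0 : (0 < z)%R by rewrite powR_gt0.
have z1 : (z < 1)%R by apply: powR2_lt1; rewrite subr_lt0.
have K0 : (0 < 2 `^ p / (1 - z))%R by rewrite divr_gt0 ?powR_gt0// subr_gt0.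
have I0 : 0 <= I by apply: integral_ge0 => s _; exact: hcontent_ge0.
have [|Iy] := leP +oo I.
  by rewrite leye_eq => /eqP ->; rewrite gt0_muley ?leey// lte_fin mulr_gt0.
pose q k : R := ((2 ^+ k) `^ (gamma / beta))%R.
pose c k : R := ((2 ^+ k / 2) `^ p)%R.
have c0 k : (0 < c k)%R by rewrite powR_gt0// divr_gt0// exprn_gt0.
have q0 k : (0 < q k)%R by rewrite powR_gt0 ?exprn_gt0.
have u0 k s : 0 <= (q k)%:E * phi (c k * s) by rewrite mule_ge0// lee_fin ltW.
have mphi k : measurable_fun setT (fun s => phi (c k * s)).
  apply: nonincreasing_emeasurable => // x y xy; apply: phi_ni.
  by rewrite ler_pM2l.
have mphi_ k (A : set R) : measurable A -> measurable_fun A (fun s => phi (c k * s)).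
  by move=> mA; exact: measurable_funTS.
have mu_ k : measurable_fun (`]0%R, +oo[%classic : set R)
    (fun s => (q k)%:E * phi (c k * s)).
  by apply: emeasurable_funM => //; exact: mphi_.
have msum : measurable_fun (`]0%R, +oo[%classic : set R)
    (fun s => \sum_(0 <= k <oo) (q k)%:E * phi (c k * s)).
  by apply: ge0_emeasurable_sum => // k s _ _; exact: u0.
pose psi (s : R) := hcontent gamma
  [set x | [set: 'rV[R]_n] x /\ s%:E < hmaximal beta D f x `^ p].
have mpsi : measurable_fun (`]0%R, +oo[%classic : set R) psi.
  apply: nonincreasing_emeasurable => // x y xy; apply: le_hcontent => w [_ yw].
  by split => //; apply: le_lt_trans yw; rewrite lee_fin.
apply: (@le_trans _ _ (\int[mu]_(s in `]0%R, +oo[)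
    ((2 * 10 `^ gamma)%:E * \sum_(0 <= k <oo) (q k)%:E * phi (c k * s)))).
  apply: ge0_le_integral => //.
  - by move=> s _; exact: hcontent_ge0.
  - exact: emeasurable_funM.
  move=> s /=; rewrite in_itv/= andbT => s0.
  have sp0 : (0 < s `^ p^-1)%R by rewrite powR_gt0.
  apply: (@le_trans _ _ (hcontent gamma [set x | (s `^ p^-1)%:E < hmaximal beta D f x])).
    apply: le_hcontent => x [_]; rewrite /= !ltNge; apply: contra => Mx.
    have -> : s = ((s `^ p^-1) `^ p)%R.
      by rewrite -powRrM mulVf ?gt_eqF// powRr1// ltW.
    rewrite -poweR_EFin; apply: gt0_ler_poweR => //; first exact: ltW.
    - by rewrite in_itv/= leey andbT hmaximal_ge0.
    - by rewrite in_itv/= leey andbT lee_fin ltW.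
  apply: le_trans (hcontent_hmaximal_le_choquet_level _ sp0) _.
  rewrite lee_wpmul2l ?lee_fin ?(ltW C0)//.
  rewrite le_eqVlt; apply/orP; left; apply/eqP; apply: eq_eseriesr => k _.
  congr (_ * phi _).
  rewrite mulrA mulrAC powRM ?divr_ge0 ?exprn_ge0 ?ltW//.
  by rewrite -powRrM mulVf ?gt_eqF// powRr1// ltW.
rewrite ge0_integralZl//; last first.
  by move=> s _; apply: nneseries_ge0 => k _ _; exact: u0.
rewrite [X in _ <= X * I]EFinM -muleA lee_wpmul2l ?lee_fin ?(ltW C0)//.
(* All terms are nonnegative, so sum and integral are interchanged. *)
rewrite integral_nneseries//.
have [J IE] : exists J, I = J%:E.
  by exists (fine I); rewrite fineK// ge0_fin_numE.
have J0 : (0 <= J)%R by rewrite -lee_fin -IE.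
have Ik k : \int[mu]_(s in `]0%R, +oo[) ((q k)%:E * phi (c k * s)) =
    (2 `^ p * z ^+ k * J)%:E.
  rewrite ge0_integralZl//; [|exact: mphi_|by rewrite lee_fin ltW].
  rewrite ge0_integral_scale//; last exact: nonincreasing_emeasurable.
  rewrite (_ : integral _ _ _ = J%:E)// muleA -[(q k)%:E * _]EFinM -EFinM.
  congr (_ * _)%:E.
  have powX (y : R) : ((2 ^+ k) `^ y = (2 `^ y) ^+ k)%R.
    by rewrite -powR_mulrn// powRAC powR_mulrn ?powR_ge0.
  rewrite /q /c /z powRB ?pnatr_eq0 ?implybT// powRM ?exprn_ge0//.
  rewrite !powX -(powR_inv1 (ler0n _ 2)) -powRrM mulN1r powRN expr_div_n.
  by field; rewrite !expf_neq0 ?gt_eqF ?powR_gt0.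
under eq_eseriesr do rewrite Ik.
apply: lime_le.
  apply: is_cvg_nneseries => k _ _.
  by rewrite lee_fin !mulr_ge0 ?powR_ge0 ?exprn_ge0 ?(ltW z0) .
apply: nearW => N; rewrite sumEFin IE -EFinM lee_fin -mulr_suml.
rewrite ler_wpM2r //.
have := @geometric_le_lim _ N (2 `^ p)%R z (powR_ge0 _ _) z0.
rewrite ger0_norm ?(ltW z0)// => /(_ z1).
by rewrite /series/=.
Qed.

End choquet_hmaximal.

Theorem corollary1p4 (R : realType) (n : nat) (gamma beta p : R)
    (hgamma : 0 < gamma) (hgb : gamma < beta) (hbeta : beta <= n%:R)
    (hp : gamma / beta <= p) :
  (gamma / beta < p ->
     exists2 C : R, 0 < C &
       forall (D : set 'rV[R]_n) (f : 'rV[R]_n -> R),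
         Lp_hcontent gamma p D f ->
         (choquet gamma setT (fun x => hmaximal beta D f x `^ p)
            <= C%:E * choquet gamma D (fun x => (`|f x| `^ p)%:E))%E)
  /\
  (p = gamma / beta ->
     exists2 C : R, 0 < C &
       forall (D : set 'rV[R]_n) (f : 'rV[R]_n -> R),
         Lp_hcontent gamma p D f ->
         forall t : R, 0 < t ->
         (hcontent gamma [set x | t%:E < hmaximal beta D f x]
            <= (C / t `^ p)%:E * choquet gamma D (fun x => (`|f x| `^ p)%:E))%E).
Proof.
have p0 : 0 < p.
  by rewrite (lt_le_trans _ hp)// divr_gt0// (lt_trans hgamma).
split=> [gbp|pE].
- exists (2 * 10 `^ gamma * (2 `^ p / (1 - 2 `^ (gamma / beta - p)))).
    rewrite !mulr_gt0 ?powR_gt0// invr_gt0 subr_gt0 powR2_lt1//.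
    by rewrite subr_lt0.
  by move=> D f _; exact: strong_hmaximal.
- exists (2 * 10 `^ gamma / (2^-1 `^ p - 4^-1 `^ p)).
    rewrite divr_gt0 ?mulr_gt0 ?powR_gt0// subr_gt0 gt0_ltr_powR ?nnegrE//; lra.
  by move=> D f _ t t0; exact: weak_hmaximal.
Qed.
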